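(* Let $A$ be a finite alphabet. Considered both as families of languages (defined by sentences) and as families of sets of marked words (defined by formulas with one free variable), the logics $FO^2[<,\mathrm{bet}]$ and $FO^2[<,\mathrm{th}]$ over $A$ have the same expressive power: every sentence (resp. formula with one free variable) of one logic is equivalent to a sentence (resp. formula with one free variable) of the other.
   Context: Words over a finite alphabet $A$ are interpreted as finite structures whose positions are $1,\dots,|w|$; $w(i)$ is the $i$-th letter. A marked word is a pair $(w,i)$ with $w$ nonempty and $1\le i\le |w|$. In first-order logic over words, for each $a\in A$ there is a unary predicate $a(x)$ (''the letter at position $x$ is $a$'') and the binary order $<$ on positions. Sentences may be evaluated in the empty word, where every existentially quantified sentence is false. $FO^2[<,\mathrm{bet}]$ consists of the first-order formulas that use only two variable symbols (which may be reused/requantified), built from $x<y$, the unary predicates $a(x)$, and for each $a\in A$ the binary predicate $a(x,y)$, interpreted as: there is a position $z$ with $x<z<y$ and $w(z)=a$. $FO^2[<,\mathrm{th}]$ is the two-variable logic built from $<$, the unary letter predicates and, for each $a\in A$ and each integer $k\ge 0$, the binary predicate $(a,k)(x,y)$, interpreted as: $x<y$ and there are at least $k$ positions $z$ with $x<z<y$ and $w(z)=a$. *)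

(* Defs.v *)
From mathcomp Require Import all_boot.
Set Implicit Arguments.
Unset Strict Implicit.
Unset Printing Implicit Defensive.

(* Positions of w are the natural numbers 1, ..., size w. *)

Section Words.
Variable A : finType.
Implicit Type w : seq A.

Definition positions w : seq nat := iota 1 (size w).

(* None when p is not a position of w. *)
Definition letter w (p : nat) : option A :=
  if p is q.+1 then onth w q else None.

Definition strictly_between w (a : A) (p q z : nat) : bool :=
  (p < z < q) && (letter w z == Some a).

(* A two-variable logic over words is determined by the binary predicates it
   has in addition to the order and the letter predicates. *)
Record logic := Logic {
  binpred : Type;
  interp : binpred -> seq A -> nat -> nat -> bool }.

Definition FO2_bet : logic :=
  @Logic A (fun a w p q => has (strictly_between w a p q) (positions w)).

Definition FO2_th : logic :=
  @Logic (A * nat)%type (fun ak w p q =>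
    (p < q) && (ak.2 <= count (strictly_between w ak.1 p q) (positions w))).

End Words.

(* The two variable symbols. *)
Notation var := bool.

(* Equality is not primitive: on positions, x = y amounts to
   ~ x < y /\ ~ y < x. *)
Inductive formula (A : finType) (L : logic A) : Type :=
| Lt of var & var
| Letter of A & var
| Bin of binpred L & var & var
| Neg of formula L
| And of formula L & formula L
| Or of formula L & formula L
| Ex of var & formula L
| All of var & formula L.

Section Semantics.
Variables (A : finType) (L : logic A).

Definition update (v : var -> nat) (x : var) (p : nat) : var -> nat :=
  fun y => if y == x then p else v y.

Fixpoint sat (w : seq A) (v : var -> nat) (phi : formula L) : bool :=
  match phi with
  | Lt x y => v x < v y
  | Letter a x => letter w (v x) == Some a
  | Bin b x y => interp b w (v x) (v y)
  | Neg f => ~~ sat w v f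
  | And f g => sat w v f && sat w v g
  | Or f g => sat w v f || sat w v g
  | Ex x f => has (fun p => sat w (update v x p) f) (positions w)
  | All x f => all (fun p => sat w (update v x p) f) (positions w)
  end.

Fixpoint free (phi : formula L) (z : var) : bool :=
  match phi with
  | Lt x y => (z == x) || (z == y)
  | Letter _ x => z == x
  | Bin _ x y => (z == x) || (z == y)
  | Neg f => free f z
  | And f g => free f z || free g z
  | Or f g => free f z || free g z
  | Ex x f => (z != x) && free f z
  | All x f => (z != x) && free f z
  end.

Definition sentence (phi : formula L) : Prop := forall z, free phi z = false.

Definition only_free (x : var) (phi : formula L) : Prop :=
  forall z, free phi z = (z == x).

(* The truth of a sentence does not depend on the valuation, so the dummy
   value 0, which is never a position, also serves for the empty word. *)
Definition models (w : seq A) (phi : formula L) : bool := sat w (fun=> 0) phi.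

(* For a formula whose only free variable is x, only the value i of x
   matters. *)
Definition models_at (w : seq A) (i : nat) (phi : formula L) : bool :=
  sat w (fun=> i) phi.

End Semantics.

Definition translates (A : finType) (L L' : logic A) : Prop :=
  (forall phi : formula L, sentence phi ->
     exists2 psi : formula L', sentence psi &
       forall w : seq A, models w phi = models w psi) /\
  (forall (x : var) (phi : formula L), only_free x phi ->
     exists2 psi : formula L', only_free x psi &
       forall (w : seq A) (i : nat), 1 <= i <= size w ->
         models_at w i phi = models_at w i psi).

(* Main.v *)
Require Import Defs.
From mathcomp Require Import all_boot.
From mathcomp Require Import zify.

(** Counting reduces to betweenness because a threshold can be consumed one
    letter at a time. To say that some [q] after [p] satisfies a condition on
    the numbers of letters between [p] and [q], each counted up to a cap
    [K a], jump to the nearest position [z] after [p] that carries a letter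
    [a] with [K a > 0]. If there is no such [z] before [q], all relevant counts
    are zero; otherwise the same kind of condition is imposed at [z], with
    [K a] lowered by one, and "nearest" only needs betweenness. Every
    two-variable formula over thresholds depends on the order of its two
    variables, on finitely many unary properties of each, and on capped counts,
    so quantifiers can be eliminated from the inside out. *)

Set Implicit Arguments.
Unset Strict Implicit.
Unset Printing Implicit Defensive.

Lemma eq_sat (A : finType) (L : logic A) (phi : formula L) w
    (v v' : var -> nat) :
  (forall z, free phi z -> v z = v' z) -> sat w v phi = sat w v' phi.
Proof.
elim: phi v v' => [x y|a x|b x y|f IH|f IHf g IHg|f IHf g IHg|x f IH|x f IH]
  v v' /= eq_v.
- by rewrite !eq_v ?eqxx ?orbT.
- by rewrite eq_v.
- by rewrite !eq_v ?eqxx ?orbT.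
- by rewrite (IH v v').
- by rewrite (IHf v v') ?(IHg v v') // => z fz; rewrite eq_v ?fz ?orbT.
- by rewrite (IHf v v') ?(IHg v v') // => z fz; rewrite eq_v ?fz ?orbT.
- apply: eq_has => p; apply: IH => z fz; rewrite /update.
  by case: eqVneq => // zx; rewrite eq_v ?zx.
- apply: eq_all => p; apply: IH => z fz; rewrite /update.
  by case: eqVneq => // zx; rewrite eq_v ?zx.
Qed.

(** * From betweenness to thresholds *)

Section BetToTh.
Variable A : finType.

Fixpoint th_of_bet (phi : formula (FO2_bet A)) : formula (FO2_th A) :=
  match phi with
  | Lt x y => Lt _ x y
  | Letter a x => Letter _ a x
  | Bin a x y => @Bin A (FO2_th A) (a, 1) x y
  | Neg f => Neg (th_of_bet f)
  | And f g => And (th_of_bet f) (th_of_bet g)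
  | Or f g => Or (th_of_bet f) (th_of_bet g)
  | Ex x f => Ex x (th_of_bet f)
  | All x f => All x (th_of_bet f)
  end.

Lemma free_th_of_bet phi z : free (th_of_bet phi) z = free phi z.
Proof.
by elim: phi => [x y|a x|a x y|f IH|f IHf g IHg|f IHf g IHg|x f IH|x f IH] /=;
  rewrite ?IH ?IHf ?IHg.
Qed.

Lemma sat_th_of_bet phi w v : sat w v (th_of_bet phi) = sat w v phi.
Proof.
elim: phi v => [x y|a x|a x y|f IH|f IHf g IHg|f IHf g IHg|x f IH|x f IH] v //=.
(* Betweenness is threshold 1; the explicit conjunct [x < y] follows from any witness [z]. *)
- rewrite -has_count andb_idl // => /hasP[z _ /andP[/andP[xz zy] _]].
  exact: ltn_trans zy.
- by rewrite IH.
- by rewrite IHf IHg.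
- by rewrite IHf IHg.
- by apply: eq_has => p; apply: IH.
- by apply: eq_all => p; apply: IH.
Qed.

Lemma translates_bet_th : translates (FO2_bet A) (FO2_th A).
Proof.
split=> [phi phiS|x phi phix]; exists (th_of_bet phi).
- by move=> z; rewrite free_th_of_bet.
- by move=> w; rewrite /models sat_th_of_bet.
- by move=> z; rewrite free_th_of_bet.
- by move=> w i _; rewrite /models_at sat_th_of_bet.
Qed.

End BetToTh.

(** * From thresholds to betweenness: counting letters between two positions *)

Section ThToBet.
Variable A : finType.
Implicit Types (w : seq A) (a : A) (p q z : nat) (d : bool).

(* One of the two summands is always zero, which makes the count symmetric. *)
Definition between_count w p q a : nat :=
  count (strictly_between w a p q) (positions w) +
  count (strictly_between w a q p) (positions w).

Definition before d p q : bool := if d then p < q else q < p.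

Lemma between_countC w p q : between_count w p q =1 between_count w q p.
Proof. by move=> a; rewrite /between_count addnC. Qed.

Lemma count_between_geq w a p q :
  q <= p -> count (strictly_between w a p q) (positions w) = 0.
Proof.
move=> qp; apply/eqP; rewrite -leqn0 leqNgt -has_count.
by apply/hasP => -[z _ /andP[pzq _]]; lia.
Qed.

Lemma between_count_ltn w p q a :
  p < q -> between_count w p q a =
           count (strictly_between w a p q) (positions w).
Proof.
by move=> pq; rewrite /between_count (count_between_geq _ _ (ltnW pq)) addn0.
Qed.

Lemma between_countpp w p a : between_count w p p a = 0.
Proof. by rewrite /between_count !count_between_geq. Qed.

Lemma between_count_eq0 w p q a :
  (between_count w p q a == 0) =
  ~~ has (strictly_between w a p q) (positions w) &&
  ~~ has (strictly_between w a q p) (positions w).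
Proof. by rewrite addn_eq0 !has_count -!leqNgt !leqn0. Qed.

Lemma count_between_split w a p z q :
  z \in positions w -> p < z -> z < q ->
  count (strictly_between w a p q) (positions w) =
  count (strictly_between w a p z) (positions w) +
  (letter w z == Some a) +
  count (strictly_between w a z q) (positions w).
Proof.
move=> zw pz zq.
(* Writing the middle summand as a count over the same duplicate-free list lets the identity be
   checked one position at a time. *)
have ->: (letter w z == Some a : nat) =
    count (fun y => (y == z) && (letter w z == Some a)) (positions w).
  case: (letter w z == Some a).
    rewrite (eq_count (a2 := pred1 z)) => [|y]; last by rewrite /= andbT.
    by rewrite count_uniq_mem ?iota_uniq // zw.
  by rewrite (eq_count (a2 := pred0)) ?count_pred0 // => y; rewrite andbF.
elim: (positions w) => //= y s ->.
rewrite /strictly_between; case: (ltngtP y z) => [yz|zy|->] /=.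
- by case: (letter w y == Some a); lia.
- by case: (letter w y == Some a); lia.
- by case: (letter w z == Some a); lia.
Qed.

Lemma between_count_split w a d p z q :
  z \in positions w -> before d p z -> before d z q ->
  between_count w p q a =
  between_count w z q a + (letter w z == Some a) + between_count w p z a.
Proof.
case: d => /= zw pz zq.
  rewrite !between_count_ltn // ?(ltn_trans pz) //.
  by rewrite (count_between_split _ zw pz zq); lia.
rewrite (between_countC w p) (between_countC w z) (between_countC w p z).
rewrite !between_count_ltn // ?(ltn_trans zq) //.
by rewrite (count_between_split _ zw zq pz).
Qed.

Lemma before_trans d p z q : before d p z -> before d z q -> before d p q.
Proof. by case: d => /=; lia. Qed.

Lemma between_count_gt0 w a d p q :
  before d p q -> 0 < between_count w p q a ->
  exists z, [/\ z \in positions w, before d p z, before d z q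
              & letter w z == Some a].
Proof.
rewrite lt0n between_count_eq0 negb_and !negbK; case: d => /= pq.
  case/orP => /hasP[z zw /andP[/andP[z1 z2] za]]; last by lia.
  by exists z.
case/orP => /hasP[z zw /andP[/andP[z1 z2] za]]; first by lia.
by exists z.
Qed.

Lemma nearest_letter w d (S : pred A) p q :
  before d p q -> ~~ [forall (a | S a), between_count w p q a == 0] ->
  exists z a, [/\ z \in positions w, before d p z, before d z q,
    S a & letter w z == Some a] /\
    [forall (b | S b), between_count w p z b == 0].
Proof.
have [n] := ubnP ((p - q) + (q - p)); elim: n q => // n IH q le_n pq.
rewrite negb_forall => /existsP[a]; rewrite negb_imply -lt0n.
case/andP=> Sa /(between_count_gt0 pq)[z [zw pz zq za]].
have [noS|someS] := boolP [forall (b | S b), between_count w p z b == 0].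
  by exists z, a.
have le_z : (p - z) + (z - p) < n by case: (d) pq pz zq => /=; lia.
have [y [b [[yw py yz Sb yb] noS]]] := IH z le_z pz someS.
by exists y, b; split=> //; split=> //; apply: before_trans yz zq.
Qed.

(** * Unary properties definable with betweenness *)

(** A formula is required for either variable symbol, so that a property can be stated of the other
    variable under a quantifier. *)
Definition definable (P : seq A -> nat -> bool) : Prop :=
  forall x : var, exists2 psi : formula (FO2_bet A), only_free x psi &
    forall w v, v x \in positions w -> sat w v psi = P w (v x).

Lemma eq_definable P P' :
  (forall w p, p \in positions w -> P w p = P' w p) ->
  definable P -> definable P'.
Proof.
move=> eqP defP x; have [psi psix satP] := defP x.
by exists psi => // w v vx; rewrite satP ?eqP.
Qed.

(** [x < x] serves as falsity because the formula must have [x] free. *)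
Lemma definable_const b : definable (fun _ _ => b).
Proof.
move=> x; case: b.
  exists (Neg (Lt _ x x)) => [z|w v _] /=; first by rewrite orbb.
  by rewrite ltnn.
exists (Lt _ x x) => [z|w v _] /=; first by rewrite orbb.
by rewrite ltnn.
Qed.

Lemma definable_letter a : definable (fun w p => letter w p == Some a).
Proof. by move=> x; exists (Letter _ a x). Qed.

Lemma definable_neg P : definable P -> definable (fun w p => ~~ P w p).
Proof.
move=> defP x; have [f fx satf] := defP x.
by exists (Neg f) => //= w v vx; rewrite satf.
Qed.

Lemma definable_and P Q :
  definable P -> definable Q -> definable (fun w p => P w p && Q w p).
Proof.
move=> defP defQ x; have [f fx satf] := defP x; have [g gx satg] := defQ x.
exists (And f g) => [z|w v vx] /=; first by rewrite fx gx orbb.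
by rewrite satf ?satg.
Qed.

Lemma definable_or P Q :
  definable P -> definable Q -> definable (fun w p => P w p || Q w p).
Proof.
move=> defP defQ x; have [f fx satf] := defP x; have [g gx satg] := defQ x.
exists (Or f g) => [z|w v vx] /=; first by rewrite fx gx orbb.
by rewrite satf ?satg.
Qed.

Lemma definable_exists (I : finType) (P : I -> seq A -> nat -> bool) :
  (forall i, definable (P i)) -> definable (fun w p => [exists i, P i w p]).
Proof.
move=> defP.
have defs s : definable (fun w p => has (fun i => P i w p) s).
  elim: s => [|i s IH] /=; first exact: definable_const.
  exact: definable_or.
apply: eq_definable (defs (enum I)) => w p _.
apply/hasP/existsP => [[i _ Pi]|[i Pi]]; first by exists i.
by exists i; rewrite ?mem_enum.
Qed.

Definition order_formula d (x y : var) : formula (FO2_bet A) :=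
  if d then Lt _ x y else Lt _ y x.

Definition none_between (s : seq A) (x y : var) : formula (FO2_bet A) :=
  foldr (fun a f => And (And (Neg (@Bin A (FO2_bet A) a x y))
                             (Neg (@Bin A (FO2_bet A) a y x))) f)
        (Neg (Lt _ x x)) s.

Lemma definable_next d (S : pred A) P :
  definable P ->
  definable (fun w p => has (fun q => [&& before d p q, P w q
    & [forall (a | S a), between_count w p q a == 0]]) (positions w)).
Proof.
move=> defP x; have [f fy satf] := defP (~~ x).
exists (Ex (~~ x) (And (order_formula d x (~~ x))
                  (And f (none_between (enum S) x (~~ x))))) => [z|w v vx].
  (* Only an inclusion: for empty [s] the variable [y] does not occur. The order formula supplies
     both variables. *)
  have free_none s y : free (none_between s x y) z ==> (z == x) || (z == y).
    by elim: s => /= [|a s]; case: (z == x); case: (z == y).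
  move: {free_none}(free_none (enum S) (~~ x)); rewrite /= fy.
  by case: (free _ z); case: d; case: (x); case: z.
rewrite /=; apply: eq_in_has => q qw.
have upd_x : update v (~~ x) q x = v x by rewrite /update; case: (x).
have upd_y : update v (~~ x) q (~~ x) = q by rewrite /update eqxx.
rewrite satf ?upd_y //; congr [&& _, _ & _].
  by rewrite /order_formula; case: d => /=; rewrite upd_x upd_y.
transitivity (all (fun a => between_count w (v x) q a == 0) (enum S)).
  elim: (enum S) => /= [|a s ->]; first by rewrite ltnn.
  by rewrite between_count_eq0 upd_x upd_y.
apply/allP/forall_inP => noS a; last by rewrite mem_enum; apply: noS.
by move=> Sa; apply: noS; rewrite mem_enum.
Qed.

(** * Capped counting conditions *)

Definition capped (K : A -> nat) (B : Type) (f : (A -> nat) -> B) : Prop :=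
  forall m m', (forall a, minn (m a) (K a) = minn (m' a) (K a)) -> f m = f m'.

(** By induction on the total cap [\sum_a K a]: each jump to a nearest relevant letter lowers it by
    one. *)
Lemma definable_next_count d K (C : seq A -> nat -> (A -> nat) -> bool) :
  (forall m, definable (fun w q => C w q m)) ->
  (forall w q, capped K (C w q)) ->
  definable (fun w p => has (fun q =>
    before d p q && C w q (between_count w p q)) (positions w)).
Proof.
have [n] := ubnP (\sum_a K a); elim: n K C => // n IH K C le_n defC capC.
pose S a := 0 < K a.
pose K' a b := K b - (b == a).
(* Counting restarts at the intermediate position, whose own letter [a] is added back. *)
pose C' a w q m := C w q (fun b => m b + (b == a)).
have defC' a : S a -> definable (fun w z => has (fun q =>
    before d z q && C' a w q (between_count w z q)) (positions w)).
  move=> Sa; apply: (IH (K' a)) => [|m|w q m m' eq_m].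
  - apply: leq_trans (_ : _ < \sum_b K b) le_n; rewrite (bigD1 a) //= [X in _ < X](bigD1 a) //=.
    rewrite /K' eqxx.
    have: \sum_(i | i != a) (K i - (i == a)) <= \sum_(i | i != a) K i.
      by apply: leq_sum => i _; apply: leq_subr.
    by move: Sa; rewrite /S; lia.
  - exact: defC.
  - by apply: capC => b; have := eq_m b; rewrite /K'; lia.
pose none w p q := [forall (a | S a), between_count w p q a == 0].
(* If no relevant letter lies in between, the counts may be replaced by the constant zero. *)
have def0 := definable_next d S (defC (fun=> 0)).
pose viaP a w z := S a && ((letter w z == Some a) && has (fun q =>
    before d z q && C' a w q (between_count w z q)) (positions w)).
have defvia a : definable (viaP a).
  rewrite /viaP; case Sa: (S a); last exact: definable_const.
  exact: definable_and (definable_letter a) (defC' a Sa).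
have capCK w q a z p : S a -> letter w z == Some a ->
    z \in positions w -> before d p z -> before d z q -> none w p z ->
    C w q (between_count w p q) = C' a w q (between_count w z q).
  move=> Sa /eqP za zw pz zq noS; apply: capC => b.
  rewrite (between_count_split b zw pz zq) za.
  have -> : (Some a == Some b) = (b == a) by rewrite eq_sym.
  have [Sb|] := boolP (S b); last by rewrite /S; lia.
  by rewrite (eqP (forall_inP noS b Sb)) addn0.
have capC0 w p q : none w p q -> C w q (between_count w p q) = C w q (fun=> 0).
  move=> noS; apply: capC => b.
  have [Sb|] := boolP (S b); last by rewrite /S; lia.
  by rewrite (eqP (forall_inP noS b Sb)).
have := definable_or def0
  (definable_exists (fun a => definable_next d S (defvia a))).
apply: eq_definable => w p pw; apply/idP/idP.
  case/orP => [/hasP[q qw /and3P[pq Cq noS]]|/existsP[a /hasP[z zw]]].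
    by apply/hasP; exists q => //; rewrite pq capC0.
  case/and3P=> pz /and3P[Sa za /hasP[q qw /andP[zq Cq]]] noS.
  apply/hasP; exists q => //.
  by rewrite (before_trans pz zq) (capCK w q a z p).
case/hasP=> q qw /andP[pq Cq].
have [noS|someS] := boolP (none w p q).
  apply/orP; left; apply/hasP; exists q => //.
  by apply/and3P; split; rewrite // -(capC0 w p).
have [z [a [[zw pz zq Sa za] noS]]] := nearest_letter pq someS.
apply/orP; right; apply/existsP; exists a; apply/hasP; exists z => //.
rewrite pz noS andbT /viaP Sa za /=; apply/hasP; exists q => //.
by rewrite zq -(capCK w q a z p).
Qed.

(** * Separable binary relations *)

(* The finite type [T] collects the unary properties on which [R] depends; a
   product of such types serves two relations at once. *)
Definition separable (R : seq A -> nat -> nat -> bool) : Prop :=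
  exists (T : finType) (col : seq A -> nat -> T) (K : A -> nat)
    (f : bool -> bool -> T -> T -> (A -> nat) -> bool),
  [/\ forall t, definable (fun w p => col w p == t),
      forall b c t u, capped K (f b c t u) &
      forall w p q, p \in positions w -> q \in positions w ->
        R w p q =
        f (p < q) (q < p) (col w p) (col w q) (between_count w p q)].

Lemma eq_separable R R' :
  (forall w p q, p \in positions w -> q \in positions w ->
     R w p q = R' w p q) ->
  separable R -> separable R'.
Proof.
move=> eqR [T [col [K [f [defc capf fP]]]]]; exists T, col, K, f.
by split=> // w p q pw qw; rewrite -eqR ?fP.
Qed.

Lemma separable_definable P : definable P -> separable (fun w p _ => P w p).
Proof.
move=> defP; exists bool, P, (fun=> 0), (fun _ _ t _ _ => t); split=> // -[].
  by apply: eq_definable defP => w p _; case: (P w p).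
by apply: eq_definable (definable_neg defP) => w p _; case: (P w p).
Qed.

Lemma separable_lt : separable (fun _ p q => p < q).
Proof.
exists unit, (fun _ _ => tt), (fun=> 0), (fun b _ _ _ _ => b); split=> // -[].
by apply: eq_definable (definable_const true).
Qed.

Lemma separable_count a k :
  separable (fun w p q => k <= between_count w p q a).
Proof.
exists unit, (fun _ _ => tt), (fun=> k), (fun _ _ _ _ m => k <= m a).
split=> // [[]|_ _ _ _ m m' eq_m].
  by apply: eq_definable (definable_const true).
by have := eq_m a; lia.
Qed.

Lemma separable_swap R : separable R -> separable (fun w p q => R w q p).
Proof.
case=> T [col [K [f [defc capf fP]]]].
exists T, col, K, (fun b c t u m => f c b u t m); split=> // w p q pw qw.
by rewrite fP //; apply: capf => a; rewrite between_countC.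
Qed.

Lemma separable_neg R : separable R -> separable (fun w p q => ~~ R w p q).
Proof.
case=> T [col [K [f [defc capf fP]]]].
exists T, col, K, (fun b c t u m => ~~ f b c t u m).
split=> // [b c t u m m' eq_m|w p q pw qw]; last by rewrite fP.
by rewrite (capf _ _ _ _ _ _ eq_m).
Qed.

Lemma separable_and R R' :
  separable R -> separable R' -> separable (fun w p q => R w p q && R' w p q).
Proof.
case=> T [col [K [f [defc capf fP]]]] [T' [col' [K' [f' [defc' capf' fP']]]]].
exists (T * T')%type, (fun w p => (col w p, col' w p)),
  (fun a => K a + K' a),
  (fun b c t u m => f b c t.1 u.1 m && f' b c t.2 u.2 m).
split=> [[t t']|b c t u m m' eq_m|w p q pw qw] /=.
- by apply: eq_definable (definable_and (defc t) (defc' t')) => w p _.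
- by congr (_ && _); [apply: capf|apply: capf'] => a; have := eq_m a; lia.
- by rewrite fP ?fP'.
Qed.

Lemma separable_or R R' :
  separable R -> separable R' -> separable (fun w p q => R w p q || R' w p q).
Proof.
move=> sR sR'.
have := separable_neg (separable_and (separable_neg sR) (separable_neg sR')).
by apply: eq_separable => w p q _ _; rewrite negb_and !negbK.
Qed.

(** On the diagonal both order tests fail and all counts vanish, so only the colour of [p] matters,
    and there are finitely many colours. *)
Lemma definable_diag R : separable R -> definable (fun w p => R w p p).
Proof.
case=> T [col [K [f [defc capf fP]]]].
have := definable_exists (fun t => definable_and (defc t)
  (definable_const (f false false t t (fun=> 0)))).
apply: eq_definable => w p pw; rewrite fP // ltnn.
rewrite (capf _ _ _ _ _ (fun=> 0)) => [|a]; last by rewrite between_countpp.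
apply/existsP/idP => [[t /andP[/eqP -> //]]|ft].
by exists (col w p); rewrite eqxx.
Qed.

(** The witness is [p] itself or lies on one side [d] of it. Once the side and the colour [t] of [p]
    are fixed by finite disjunctions, a capped condition on the witness and the counts remains. *)
Lemma definable_ex R :
  separable R -> definable (fun w p => has (R w p) (positions w)).
Proof.
move=> sR; have defRpp := definable_diag sR.
case: sR => T [col [K [f [defc capf fP]]]].
pose C d t w q m := f d (~~ d) t (col w q) m.
have defC d t m : definable (fun w q => C d t w q m).
  have := definable_exists (fun u => definable_and (defc u)
    (definable_const (f d (~~ d) t u m))).
  apply: eq_definable => w q _.
  apply/existsP/idP => [[u /andP[/eqP <- //]]|fu].
  by exists (col w q); rewrite eqxx.
have defnext d t :=
  definable_next_count d (defC d t) (fun w q => capf d (~~ d) t (col w q)).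
have := definable_or defRpp (definable_exists (fun d => definable_exists
  (fun t => definable_and (defc t) (defnext d t)))).
apply: eq_definable => w p pw; apply/orP/hasP.
  case=> [Rpp|/existsP[d /existsP[t /andP[/eqP pt /hasP[q qw]]]]].
    by exists p.
  case/andP=> pq; rewrite /C -pt => Cq; exists q; rewrite // fP //.
  by case: d pq Cq => /= pq; rewrite pq ltnNge (ltnW pq).
case=> q qw Rpq; have [pq|qp|eq_pq] := ltngtP p q.
- right; apply/existsP; exists true; apply/existsP; exists (col w p).
  rewrite eqxx; apply/hasP; exists q => //=; rewrite pq.
  by move: Rpq; rewrite fP // pq ltnNge (ltnW pq).
- right; apply/existsP; exists false; apply/existsP; exists (col w p).
  rewrite eqxx; apply/hasP; exists q => //=; rewrite qp.
  by move: Rpq; rewrite fP // qp ltnNge (ltnW qp).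
- by left; move: Rpq; rewrite eq_pq.
Qed.

(** * Quantifier elimination and the translation *)

Definition valuation p q : var -> nat := fun y => if y then q else p.

Lemma separable_at P x :
  definable P -> separable (fun w p q => P w (valuation p q x)).
Proof.
move=> /separable_definable sP; case: x; last exact: sP.
exact: separable_swap.
Qed.

(** When the two variables coincide, the relation reduces to its diagonal, a definable unary
    property. *)
Lemma separable_binary R x y :
  separable R ->
  separable (fun w p q => R w (valuation p q x) (valuation p q y)).
Proof.
move=> sR; case: x; case: y => /=.
- exact: separable_at true (definable_diag sR).
- exact: separable_swap.
- exact: sR.
- exact: separable_at false (definable_diag sR).
Qed.

Lemma separable_th a k :
  separable (interp (l := FO2_th A) (a, k)).
Proof.
apply: eq_separable (separable_and separable_lt (separable_count a k)).
move=> w p q _ _ /=; case: ltnP => //= pq.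
by rewrite between_count_ltn.
Qed.

(** Quantifying one variable leaves a definable property of the other, which is again separable. *)
Lemma separable_ex x (f : formula (FO2_th A)) :
  separable (fun w p q => sat w (valuation p q) f) ->
  separable (fun w p q => sat w (valuation p q) (Ex x f)).
Proof.
move=> sf; case: x.
  have := separable_at false (definable_ex sf).
  apply: eq_separable => w p q _ _ /=; apply: eq_has => r.
  by apply: eq_sat => -[].
have := separable_at true (definable_ex (separable_swap sf)).
apply: eq_separable => w p q _ _ /=; apply: eq_has => r.
by apply: eq_sat => -[].
Qed.

Lemma separable_sat (phi : formula (FO2_th A)) :
  separable (fun w p q => sat w (valuation p q) phi).
Proof.
elim: phi => [x y|a x|[a k] x y|f IH|f IHf g IHg|f IHf g IHg|x f IH|x f IH].
- exact: separable_binary separable_lt.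
- exact: separable_at (definable_letter a).
- exact: separable_binary (separable_th a k).
- exact: separable_neg.
- exact: separable_and.
- exact: separable_or.
- exact: separable_ex.
- have sNf : separable (fun w p q => sat w (valuation p q) (Neg f)).
    exact: separable_neg.
  have := separable_neg (separable_ex x sNf).
  apply: eq_separable => w p q _ _ /=; rewrite -all_predC.
  by apply: eq_all => r /=; rewrite negbK.
Qed.

Lemma definable_sat (phi : formula (FO2_th A)) :
  definable (fun w p => sat w (fun=> p) phi).
Proof.
apply: eq_definable (definable_diag (separable_sat phi)) => w p _.
by apply: eq_sat => -[].
Qed.

Lemma translates_th_bet : translates (FO2_th A) (FO2_bet A).
Proof.
split=> [phi phiS|x phi _].
  have [psi psix satpsi] := definable_sat phi true.
  (* The two quantifiers agree on nonempty words, where [psi] holds at all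
     positions or at none, and differ on the empty word. *)
  exists (if models [::] phi then All true psi else Ex true psi) => [z|w].
    by case: ifP => _ /=; rewrite psix andNb.
  have psiE p : p \in positions w ->
      sat w (update (fun=> 0) true p) psi = models w phi.
    move=> pw; rewrite satpsi //.
    by apply: eq_sat => z; rewrite phiS.
  (* On the empty word [All] is true and [Ex] is false, which matches the test on [models [::]
     phi]. *)
  case: w psiE => [_|a w psiE]; first by case: ifP.
  have tlE p : p \in iota 2 (size w) -> p \in positions (a :: w).
    by move=> pw; rewrite inE pw orbT.
  case: ifP => _; rewrite [RHS]/models [RHS]/= psiE //; apply/esym.
    by apply: andb_idr => phiw; apply/allP => p /tlE pw; rewrite psiE.
  by apply: orb_idr => /hasP[p /tlE pw]; rewrite psiE.
have [psi psix satpsi] := definable_sat phi x.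
exists psi => // w i iw; rewrite /models_at satpsi //.
by rewrite mem_iota; lia.
Qed.

End ThToBet.

Theorem theorem2p6 (A : finType) :
  translates (FO2_bet A) (FO2_th A) /\ translates (FO2_th A) (FO2_bet A).
Proof. by split; [apply: translates_bet_th|apply: translates_th_bet]. Qed.
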